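(* Let $n$ be a positive integer and let $\langle a_1,\dots,a_k\rangle\in\mathcal{A}(n)\setminus\{\langle n\rangle\}$. Put $m=a_{k-1}+1$, $n'=a_{k-1}+a_k$ and $\mu=\lfloor n'/m\rfloor-1$. Then the immediate lexicographic successor of $\langle a_1,\dots,a_k\rangle$ in $\mathcal{A}(n)$ is \[ \langle a_1,\dots,a_{k-2}\rangle \,\|\, \langle \underbrace{m,\dots,m}_{\mu}\rangle \,\|\, \langle n'-\mu m\rangle , \] where $\|$ denotes concatenation of sequences.
   Context: An ascending composition of a positive integer $n$ is a sequence of positive integers $\langle a_1,\dots,a_k\rangle$ with $a_1+\dots+a_k=n$ and $a_1\le\dots\le a_k$. $\mathcal{A}(n)$ is the set of all ascending compositions of $n$, ordered lexicographically. Every element of $\mathcal{A}(n)\setminus\{\langle n\rangle\}$ has $k\ge 2$ parts. *)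

(* Defs.v *)
From mathcomp Require Import all_boot all_order.
Set Implicit Arguments.
Unset Strict Implicit.
Unset Printing Implicit Defensive.
Import Order.TTheory.

Definition ascending_compositions (n : nat) : pred (seq nat) :=
  [pred a : seq nat |
    [&& all (fun x => 0 < x) a, sorted leq a & sumn a == n]].

(* The type [seqlexi nat] is [seq nat] with the lexicographic order
   (a proper prefix is smaller). *)
Definition lex_lt (a b : seq nat) : bool :=
  ((a : seqlexi nat) < (b : seqlexi nat))%O.

Definition immediate_lex_successor (A : pred (seq nat)) (a b : seq nat) : Prop :=
  [/\ a \in A, b \in A, lex_lt a b
    & forall c : seq nat, c \in A -> ~ (lex_lt a c /\ lex_lt c b)].

(* One-based indexing: [part a i] is a_i for 1 <= i <= size a. *)
Definition part (a : seq nat) (i : nat) : nat := nth 0 a i.-1.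

(* Main.v *)
(* Write a = p ++ [:: x; y].  A composition lying between a and the claimed
   successor also starts with p, so one may drop p.  If its next part is x, the
   sum forces it to be at most [:: x; y]; otherwise all its remaining parts are
   at least m = x + 1, and m, ..., m, r with m <= r < 2m is the least such
   sequence with its sum. *)
Require Import Defs.
From mathcomp Require Import all_boot all_order.
From mathcomp Require Import zify.

Lemma lex_lt_cons (x y : nat) (s t : seq nat) :
  lex_lt (x :: s) (y :: t) = (x < y) || (x == y) && lex_lt s t.
Proof.
rewrite /lex_lt Order.SeqLexiOrder.Exports.ltxi_cons !leEnat.
by case: ltngtP.
Qed.

Lemma lex_lt_nil (s : seq nat) : lex_lt s [::] = false.
Proof. exact: Order.SeqLexiOrder.Exports.ltxis0. Qed.

Lemma lex_lt_cat2l (p s t : seq nat) :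
  lex_lt (p ++ s) (p ++ t) = lex_lt s t.
Proof. by elim: p => //= x p IHp; rewrite lex_lt_cons ltnn eqxx. Qed.

(** A sequence that departs from [p] at some entry lies on the same side of [p ++ u] and [p ++ v]; a
    proper prefix of [p] lies below both. *)
Lemma lex_lt_between_prefix (p u v c : seq nat) :
  lex_lt (p ++ u) c -> lex_lt c (p ++ v) -> exists c', c = p ++ c'.
Proof.
elim: p c => [|x p IHp] [|z c]; rewrite ?lex_lt_nil //=; try by exists [::].
  by exists (z :: c).
rewrite !lex_lt_cons => /orP[lt_xz|/andP[/eqP <- ltc]].
  by case: ltngtP lt_xz.
rewrite ltnn eqxx /= => ltv.
by have [c' ->] := IHp c ltc ltv; exists c'.
Qed.

(** Induction on [mu]: a first part above [m] already makes [c] larger, and a first part [m] can be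
    stripped. At [mu = 0] two parts would sum to at least [m + m > r], so [c] is [[:: r]]. *)
Lemma lex_min_large_parts (m mu r : nat) (c : seq nat) :
  0 < r < m + m -> all (leq m) c -> sumn c = mu * m + r ->
  ~~ lex_lt c (nseq mu m ++ [:: r]).
Proof.
move=> r_bounds; elim: mu c => [|mu IHmu] [|w t] /=; try lia.
  by case: t => [|v t] /=; rewrite lex_lt_cons lex_lt_nil; lia.
case/andP=> le_mw le_mt sum_t; rewrite lex_lt_cons ltnNge le_mw /=.
by case: eqP => //= eq_w; apply: IHmu => //; lia.
Qed.

Lemma lex_successor_last_two (x y : nat) (c : seq nat) :
  let q := (x + y) %/ x.+1 in
  0 < y -> all (fun z => 0 < z) c -> sorted leq c -> sumn c = x + y ->
  lex_lt [:: x; y] c ->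
  ~~ lex_lt c (nseq (q - 1) x.+1 ++ [:: x + y - (q - 1) * x.+1]).
Proof.
move=> q y_gt0; case: c => [|z t]; first by rewrite lex_lt_nil.
rewrite lex_lt_cons => pos_c asc_c sum_c /orP[lt_xz|/andP[/eqP eq_xz]]; last first.
  (* With first part [x], the tail is [[:: y]] or opens with a part below [y], so it cannot exceed
     [[:: y]]. *)
  have sum_t : sumn t = y by move: sum_c => /=; lia.
  case: t {asc_c sum_c} pos_c sum_t => [|w t] /=; first by rewrite lex_lt_nil.
  case: t => [|v t] /=; rewrite lex_lt_cons ?lex_lt_nil; lia.
(* As [q - 1] does not truncate, the last part is [x.+1] plus the remainder of the division, hence
   below [x.+1 + x.+1]. *)
have q_gt0 : 0 < q by rewrite divn_gt0 //; lia.
have div_q := divn_eq (x + y) x.+1; rewrite -/q in div_q.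
have mod_lt := ltn_pmod (x + y) (ltn0Sn x).
apply: lex_min_large_parts.
- nia.
- move: asc_c => /=; rewrite (path_sortedE leq_trans) => /andP[le_zt _].
  by rewrite /= lt_xz; apply: sub_all le_zt => w; apply: leq_trans.
- nia.
Qed.

Lemma last_two_decomposition (n : nat) (a : seq nat) :
  0 < n -> sumn a = n -> a <> [:: n] -> exists p x y, a = p ++ [:: x; y].
Proof.
case/lastP: a => [|a y]; first by move=> /= n_gt0 n0; lia.
case/lastP: a => [|p x] n_gt0; first by move=> /=; rewrite addn0 => ->.
by exists p, x, y; rewrite -!cats1 -catA.
Qed.

Theorem theorem3p4 (n : nat) (a : seq nat) (n_gt0 : 0 < n)
    (a_asc : a \in ascending_compositions n) (a_neq : a <> [:: n]) :
  let k := size a in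
  let m := part a (k - 1) + 1 in
  let n' := part a (k - 1) + part a k in
  let mu := n' %/ m - 1 in
  immediate_lex_successor (ascending_compositions n) a
    (take (k - 2) a ++ nseq mu m ++ [:: n' - mu * m]).
Proof.
have /and3P[pos_a asc_a /eqP sum_a] := a_asc.
have [p [x [y eq_a]]] := last_two_decomposition _ _ n_gt0 sum_a a_neq.
lazy zeta.
have size_a : size a = (size p).+2 by rewrite eq_a size_cat addn2.
have -> : take (size a - 2) a = p by rewrite size_a subn2 eq_a take_size_cat.
have -> : part a (size a - 1) = x.
  by rewrite /part size_a subn1 eq_a nth_cat ltnn subnn.
have -> : part a (size a) = y.
  by rewrite /part size_a eq_a nth_cat ltnNge leqnSn subSnn.
rewrite addn1; set q := (x + y) %/ x.+1.
move: pos_a asc_a sum_a; rewrite eq_a all_cat sumn_cat /= addn0.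
case/and4P=> pos_p x_gt0 y_gt0 _ asc_a sum_a.
have q_gt0 : 0 < q by rewrite divn_gt0 //; lia.
have div_q := divn_eq (x + y) x.+1; rewrite -/q in div_q.
have mod_lt := ltn_pmod (x + y) (ltn0Sn x).
have sum_b : (q - 1) * x.+1 + (x + y - (q - 1) * x.+1) = x + y by nia.
set r := x + y - (q - 1) * x.+1 in sum_b *.
have r_ge : x.+1 <= r by rewrite /r; nia.
split.
- by rewrite -eq_a.
(* Unlike [sorted], [pairwise] splits over concatenation into conditions on the blocks and between
   them. *)
- have : pairwise leq (p ++ [:: x; y]).
    by rewrite -sorted_pairwise //; apply: leq_trans.
  rewrite pairwise_cat => /and3P[le_p pw_p _].
  apply/and3P; split.
  + by rewrite !all_cat pos_p all_nseq /= orbT; lia.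
  + rewrite sorted_pairwise; last exact: leq_trans.
    have le_px z : z \in p -> z <= x.
      by move=> z_p; apply: (allrelP le_p) => //; rewrite mem_head.
    rewrite !pairwise_cat pw_p /= andbT; apply/and3P; split.
    * apply/allrelP=> z w /le_px le_zx; rewrite mem_cat mem_nseq mem_seq1.
      by case/orP=> [/andP[_ /eqP ->]|/eqP ->]; lia.
    * by apply/allrelP=> z w; rewrite mem_nseq mem_seq1 => /andP[_ /eqP ->] /eqP ->.
    * by elim: (q - 1) => //= k ->; rewrite all_nseq leqnn orbT.
  + by rewrite !sumn_cat sumn_nseq /= addn0; apply/eqP; lia.
(* After [p], the successor opens with [x.+1], or with [r >= x.+1] when the constant block is empty;
   both exceed [x]. *)
- rewrite lex_lt_cat2l; case: (q - 1) => [|k] /=; rewrite lex_lt_cons; lia.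
- move=> c /and3P[pos_c asc_c /eqP sum_c] [lt_ac lt_cb].
  have [c' eq_c] := lex_lt_between_prefix _ _ _ _ lt_ac lt_cb; subst c.
  move: lt_ac lt_cb pos_c sum_c; rewrite !lex_lt_cat2l all_cat sumn_cat.
  move=> lt_ac lt_cb /andP[_ pos_c'] sum_c.
  have asc_c' : sorted leq c' by case/cat_sorted2: asc_c.
  apply/negP: lt_cb; apply: lex_successor_last_two => //; lia.
Qed.
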